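(* For every quadratic irrational $\omega>1$, the following are equivalent: (i) $\omega\in\mathscr R_B$; (ii) the BCF expansion of $\omega$ is (purely) periodic, i.e. $\omega=[\![\,\overline{a_1,\ldots,a_n}\,]\!]$ for some $n\ge1$; (iii) $\omega$ is a periodic point of the map $T_B$, i.e. $T_B^n(\omega)=\omega$ for some $n\ge1$.
   Context: A quadratic irrational is a real number of degree 2 over $\mathbb Q$; $\omega^*$ is its Galois conjugate. $\mathscr R_B$ is the set of quadratic irrationals $\omega>1$ with $0<\omega^*<1$ ($B$-reduced). Every irrational $u>1$ has a unique backward continued fraction (BCF) expansion $u=[\![a_1,a_2,a_3,\ldots]\!]:=a_1-\cfrac{1}{a_2-\cfrac{1}{a_3-\cdots}}$ with integers $a_i\ge2$. The BCF Gauss shift $T_B$ on $[1,\infty)\setminus\mathbb Q$ is $T_B(u)=\frac{1}{a_1-u}=\frac{1}{1-\{u\}}$ with $a_1=1+\lfloor u\rfloor$; it acts by $T_B([\![a_1,a_2,\ldots]\!])=[\![a_2,a_3,\ldots]\!]$. *)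

(* Defs.v *)
From HB Require Import structures.
From mathcomp Require Import all_boot all_order all_algebra.
From mathcomp Require Import all_classical all_reals all_analysis.

Set Implicit Arguments.
Unset Strict Implicit.
Unset Printing Implicit Defensive.

Import Order.TTheory GRing.Theory Num.Theory.
Import numFieldNormedType.Exports.

Local Open Scope classical_set_scope.
Local Open Scope ring_scope.

Definition is_min_poly (R : realType) (x : R) (p : {poly rat}) : Prop :=
  [/\ p \is monic, irreducible_poly p & root (map_poly ratr p) x].

(* [size p = 3] means degree 2. *)
Definition quadratic_irrational (R : realType) (x : R) : Prop :=
  exists2 p : {poly rat}, is_min_poly x p & size p = 3%N.

(* The other root of the minimal polynomial over the rationals. When [x] is a
   quadratic irrational, this root exists, is real and is unique; the default
   value 0 is only taken for other [x]. *)
Definition galois_conj (R : realType) (x : R) : R :=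
  xget 0 [set y | quadratic_irrational x /\
    exists p : {poly rat},
      [/\ is_min_poly x p, root (map_poly ratr p) y & y != x]].

Definition B_reduced (R : realType) (w : R) : Prop :=
  [/\ quadratic_irrational w, 1 < w & 0 < galois_conj w < 1].

(* The digits are indexed from 0: [bcf_convergent a N] is
   a_0 - 1/(a_1 - 1/(... - 1/a_N)). If all digits are at least 2, every
   denominator is greater than 1. *)
Fixpoint bcf_convergent (R : realType) (a : nat -> int) (N : nat) : R :=
  if N is M.+1 then
    (a 0)%:~R - (bcf_convergent R (fun i => a i.+1) M)^-1
  else (a 0)%:~R.

Definition bcf_expansion (R : realType) (u : R) (a : nat -> int) : Prop :=
  (forall i : nat, 2 <= a i) /\ bcf_convergent R a N @[N --> \oo] --> u.

Definition purely_periodic_bcf (R : realType) (u : R) : Prop :=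
  exists (a : nat -> int) (n : nat),
    [/\ bcf_expansion u a, (1 <= n)%N & forall i : nat, a (i + n)%N = a i].

Definition bcf_digit (R : realType) (u : R) : int := 1 + Num.floor u.

(* The Gauss shift is defined on all reals; its intended domain, the irrational
   numbers greater than 1, is stable under it. *)
Definition T_B (R : realType) (u : R) : R := ((bcf_digit u)%:~R - u)^-1.

(* Main.v *)
(* The Gauss shift is followed on pairs (x, y) with y the conjugate of x, both
   coordinates being moved by the digit of x.  If 0 < y < 1 < x, this is
   preserved, and the integral form A X^2 + B X + C with roots x, y keeps its
   discriminant and the sign A > 0; since C > 0 and A + B + C < 0, only finitely
   many such forms exist.  The shift being injective on such pairs, its
   orbits there are periodic.  Conversely, along a periodic orbit whose
   conjugates never drop below 1, |x - y| would strictly increase; and as soon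
   as a conjugate is below 1, all the later ones lie in ]0, 1[. *)
Require Import Defs.
From HB Require Import structures.
From mathcomp Require Import all_boot all_order all_algebra.
From mathcomp Require Import all_classical all_reals all_analysis.
From mathcomp Require Import ring lra zify.

Set Implicit Arguments.
Unset Strict Implicit.
Unset Printing Implicit Defensive.

Import Order.TTheory GRing.Theory Num.Theory.
Import numFieldNormedType.Exports.

Local Open Scope classical_set_scope.
Local Open Scope ring_scope.

(** * Irrational numbers and the digit of the Gauss shift *)

Lemma irrationalP (R : realType) (x : R) :
  irrational x <-> forall q : rat, x <> ratr q.
Proof.
split=> [xI q xq|xI].
  by apply: xI; exists q.
by move=> [q _ xq]; exact: (xI q).
Qed.

Lemma irrational_neq_int (R : realType) (x : R) (a : int) :
  irrational x -> x != a%:~R.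
Proof.
move=> /irrationalP xI; apply/eqP => xa.
by apply: (xI a%:~R); rewrite ratr_int.
Qed.

(** Linear independence of 1 and [x] over the rationals, used to compare integral quadratics with a
    common root. *)
Lemma irrational_linear_eq0 (R : realType) (x : R) (p q : int) :
  irrational x -> p%:~R * x = q%:~R -> p = 0.
Proof.
move=> /irrationalP xI pxq; apply/eqP; apply: contraT => p0.
have p0R : p%:~R != 0 :> R by rewrite intr_eq0.
exfalso; apply: (xI (q%:~R / p%:~R)).
rewrite rmorphM fmorphV /= !ratr_int -pxq.
by field.
Qed.

Lemma bcf_digit_bounds (R : realType) (x : R) :
  irrational x -> (bcf_digit x)%:~R - 1 < x < (bcf_digit x)%:~R.
Proof.
move=> xI; have /andP[lo hi] := floor_itv x.
have := irrational_neq_int (Num.floor x) xI.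
rewrite /bcf_digit eq_sym intrD => xn.
apply/andP; split; last by rewrite addrC -intrD.
by rewrite addrAC subrr add0r lt_neqAle xn.
Qed.

Lemma bcf_digit_unique (R : realType) (x : R) (a : int) :
  a%:~R - 1 < x < a%:~R -> bcf_digit x = a.
Proof.
move=> /andP[lo hi]; rewrite /bcf_digit (@floor_def _ x (a - 1)); first lia.
by rewrite subrK hi andbT intrD ltW.
Qed.

Lemma bcf_digit_ge2 (R : realType) (x : R) : 1 < x -> 2 <= bcf_digit x.
Proof.
move=> x1; rewrite /bcf_digit.
have : 1 <= Num.floor x by rewrite floor_ge_int ltW.
lia.
Qed.

Lemma T_B_gt1 (R : realType) (x : R) : irrational x -> 1 < T_B x.
Proof.
move=> /bcf_digit_bounds /andP[lo hi].
by rewrite /T_B invf_gt1 ?subr_gt0//; lra.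
Qed.

Lemma T_B_inv (R : realType) (x : R) : x = (bcf_digit x)%:~R - (T_B x)^-1.
Proof. by rewrite /T_B invrK; ring. Qed.

Lemma irrational_T_B (R : realType) (x : R) : irrational x -> irrational (T_B x).
Proof.
move=> /irrationalP xI; apply/irrationalP => q Tq.
apply: (xI ((bcf_digit x)%:~R - q^-1)).
by rewrite {1}(T_B_inv x) Tq rmorphB fmorphV /= ratr_int.
Qed.

Lemma irrational_iter_T_B (R : realType) (x : R) n :
  irrational x -> irrational (iter n (@T_B R) x).
Proof. by move=> xI; elim: n => //= n; exact: irrational_T_B. Qed.

Lemma iter_T_B_gt1 (R : realType) (x : R) n :
  irrational x -> 1 < x -> 1 < iter n (@T_B R) x.
Proof.
by move=> xI x1; case: n => //= n; apply/T_B_gt1/irrational_iter_T_B.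
Qed.

(** * Integral quadratic forms and their pairs of roots *)

(** Vieta's relations: [x] and [y] are the roots, with multiplicity, of A X^2 + B X + C. *)
Definition quadratic_pair (R : realType) (A B C : int) (x y : R) : Prop :=
  [/\ A != 0, A%:~R * (x + y) = - B%:~R & A%:~R * (x * y) = C%:~R].

(** The integer A B' - B A' equals A A' (y - z), and its product with [x] is again an integer;
    irrationality of [x] makes it vanish. *)
Lemma quadratic_pair_unique (R : realType) (A B C A' B' C' : int) (x y z : R) :
  irrational x -> quadratic_pair A B C x y -> quadratic_pair A' B' C' x z ->
  y = z.
Proof.
move=> xI [A0 sy py] [A'0 sz pz].
have AR : A%:~R != 0 :> R by rewrite intr_eq0.
have A'R : A'%:~R != 0 :> R by rewrite intr_eq0.
have e1 : (A * B' - B * A')%:~R = A%:~R * A'%:~R * (y - z) :> R.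
  rewrite intrD intrM rmorphN /= intrM.
  have -> : (B'%:~R = - (A'%:~R * (x + z)))%R by rewrite sz opprK.
  have -> : (B%:~R = - (A%:~R * (x + y)))%R by rewrite sy opprK.
  ring.
have e2 : (A * B' - B * A')%:~R * x = (C * A' - C' * A)%:~R.
  rewrite e1 intrD intrM rmorphN /= intrM -py -pz; ring.
have e0 := irrational_linear_eq0 xI e2.
move: e1; rewrite e0 => /esym/eqP.
by rewrite !mulf_eq0 (negbTE AR) (negbTE A'R) /= subr_eq0 => /eqP.
Qed.

Lemma quadratic_pair_irrational (R : realType) (A B C : int) (x y : R) :
  irrational x -> quadratic_pair A B C x y -> irrational y.
Proof.
move=> /irrationalP xI [A0 sy _]; apply/irrationalP => q yq.
have AR : A%:~R != 0 :> R by rewrite intr_eq0.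
apply: (xI (- B%:~R / A%:~R - q)).
rewrite rmorphB rmorphM fmorphV rmorphN /= !ratr_int -yq -sy.
by field.
Qed.

(* The Gauss shift on [x], extended to [y] by using the digit of [x]. *)
Definition T_B2 (R : realType) (p : R * R) : R * R :=
  (T_B p.1, ((bcf_digit p.1)%:~R - p.2)^-1).

Lemma iter_T_B2_fst (R : realType) (p : R * R) n :
  (iter n (@T_B2 R) p).1 = iter n (@T_B R) p.1.
Proof. by elim: n => //= n <-. Qed.

(** The new form arises by substituting X = a - 1/Y in A X^2 + B X + C and multiplying by Y^2. *)
Lemma quadratic_pair_T_B2 (R : realType) (A B C : int) (p : R * R) :
  irrational p.1 -> quadratic_pair A B C p.1 p.2 ->
  let a := bcf_digit p.1 in
  quadratic_pair (A * a ^+ 2 + B * a + C) (- (2 * A * a + B)) A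
    (T_B2 p).1 (T_B2 p).2.
Proof.
case: p => x y /= xI q; have yI := quadratic_pair_irrational xI q.
case: q => A0 sy py; rewrite /T_B.
have AR : A%:~R != 0 :> R by rewrite intr_eq0.
set a := bcf_digit x.
have ax : a%:~R - x != 0 by rewrite subr_eq0 eq_sym irrational_neq_int.
have ay : a%:~R - y != 0 by rewrite subr_eq0 eq_sym irrational_neq_int.
clearbody a.
have EB : (B%:~R = - (A%:~R * (x + y)))%R by rewrite sy opprK.
have e : (A * a ^+ 2 + B * a + C)%:~R = A%:~R * ((a%:~R - x) * (a%:~R - y)) :> R.
  by rewrite !intrD !intrM -py EB; ring.
split.
- by rewrite -(intr_eq0 R) e !mulf_neq0.
- rewrite e rmorphN /= intrD !intrM EB; field.
  by rewrite ax ay.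
- by rewrite e; field; rewrite ax ay.
Qed.

Lemma exists_quadratic_pair_iter (R : realType) (A B C : int) (p : R * R) n :
  irrational p.1 -> quadratic_pair A B C p.1 p.2 ->
  exists A' B' C',
    quadratic_pair A' B' C' (iter n (@T_B2 R) p).1 (iter n (@T_B2 R) p).2.
Proof.
move=> pI q; elim: n => [|n [A' [B' [C' q']]]]; first by exists A, B, C.
do 3 eexists; apply: quadratic_pair_T_B2 q'.
by rewrite iter_T_B2_fst; exact: irrational_iter_T_B.
Qed.

(** * Reduced pairs and the periodicity of their orbits *)

Definition reduced_pair (R : realType) (p : R * R) : Prop :=
  [/\ irrational p.1, 1 < p.1 & 0 < p.2 < 1].

(** The digit [a] is at least 2, so y < 1 gives a - y > 1. As [y] may be negative, this shows how an
    orbit enters the reduced pairs as well as that it stays there. *)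
Lemma reduced_pair_T_B2 (R : realType) (p : R * R) :
  irrational p.1 -> 1 < p.1 -> p.2 < 1 -> reduced_pair (T_B2 p).
Proof.
case: p => x y /= xI x1 y1; split=> /=.
- exact: irrational_T_B.
- exact: T_B_gt1.
- have : 2 <= (bcf_digit x)%:~R :> R by rewrite (ler_int _ 2) bcf_digit_ge2.
  move=> a2; rewrite invr_gt0 invf_lt1 ?subr_gt0; last by lra.
  by apply/andP; split; lra.
Qed.

Lemma iter_reduced_pair (R : realType) (p : R * R) n :
  reduced_pair p -> reduced_pair (iter n (@T_B2 R) p).
Proof.
move=> pr; elim: n => //= n [xI x1 /andP[_ y1]]; exact: reduced_pair_T_B2.
Qed.

Lemma int_norm_lt1 (R : realType) (m : int) : `|m%:~R : R| < 1 -> m = 0.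
Proof. by rewrite -intr_norm (ltr_int _ _ 1); lia. Qed.

(* The conjugates lie in [0, 1], so they reveal the digit that was dropped. *)
Lemma T_B2_inj (R : realType) (p q : R * R) :
  reduced_pair p -> reduced_pair q -> T_B2 p = T_B2 q -> p = q.
Proof.
case: p q => [x y] [z t] [/= _ _ /andP[y0 y1]] [/= _ _ /andP[t0 t1]].
rewrite /T_B2 /T_B /= => -[/invr_inj e1 /invr_inj e2].
have dig : bcf_digit x - bcf_digit z = 0.
  apply: (@int_norm_lt1 R); rewrite rmorphB /= ltr_norml.
  by apply/andP; split; lra.
move/eqP: dig; rewrite subr_eq0 => /eqP dig.
by move: e1 e2; rewrite dig => /addrI/oppr_inj -> /addrI/oppr_inj ->.
Qed.

(** With k = -(A + B + C) = A (x - 1) (1 - y), the discriminant is (A - C)^2 + 2 k A + 2 k C + k^2;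
    as A, C and k are positive integers, it bounds each of them. *)
Lemma reduced_pair_coef_bound (R : realType) (A B C : int) (p : R * R) :
  reduced_pair p -> 0 < A -> quadratic_pair A B C p.1 p.2 ->
  [/\ 0 < C, 0 < - (A + B + C), A <= B ^+ 2 - 4 * A * C,
      C <= B ^+ 2 - 4 * A * C & - (A + B + C) <= B ^+ 2 - 4 * A * C].
Proof.
case: p => x y [/= _ x1 /andP[y0 y1]] A0 [_ sy py].
have A0R : 0 < A%:~R :> R by rewrite ltr0z.
have C0 : 0 < C by rewrite -(ltr0z R) -py !mulr_gt0//; lra.
have k0 : 0 < - (A + B + C).
  have EB : (B%:~R = - (A%:~R * (x + y)))%R by rewrite sy opprK.
  rewrite -(ltr0z R) rmorphN /= !intrD -py EB.
  have -> : - (A%:~R + - (A%:~R * (x + y)) + A%:~R * (x * y))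
    = A%:~R * ((x - 1) * (1 - y)) by ring.
  by rewrite !mulr_gt0// subr_gt0.
have -> : B = - (A + C + - (A + B + C)) by ring.
move: (- (A + B + C)) k0 => k k0.
have -> : (- (A + C + k)) ^+ 2 - 4 * A * C
  = (A - C) ^+ 2 + 2 * k * A + 2 * k * C + k ^+ 2 by ring.
have := sqr_ge0 (A - C).
split; nia.
Qed.

Lemma exists_quadratic_pair_iter_discr (R : realType) (A B C : int) (p : R * R) n :
  reduced_pair p -> 0 < A -> quadratic_pair A B C p.1 p.2 ->
  exists f : int * int * int,
    [/\ 0 < f.1.1, quadratic_pair f.1.1 f.1.2 f.2
          (iter n (@T_B2 R) p).1 (iter n (@T_B2 R) p).2 &
        f.1.2 ^+ 2 - 4 * f.1.1 * f.2 = B ^+ 2 - 4 * A * C].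
Proof.
move=> pr A0 q; elim: n => [|n [[[A' B'] C'] [A'0 q' D']]].
  by exists (A, B, C).
have pnr := iter_reduced_pair n pr.
rewrite iterS; move: (iter n _ p) pnr q' => r rr q'.
have [rI _ _] := rr.
have qT := quadratic_pair_T_B2 rI q'.
rewrite /= in A'0 q' D' qT; set a := bcf_digit r.1 in qT.
exists (A' * a ^+ 2 + B' * a + C', - (2 * A' * a + B'), A').
split=> /=; [|exact: qT|by rewrite -D'; ring].
case: qT => [nz _ e].
have [_ Tr1 /andP[Tr0 _]] : reduced_pair (T_B2 r).
  by case: rr => ? ? /andP[_ ?]; exact: reduced_pair_T_B2.
(* The new leading coefficient times the positive product of the new roots is the old leading
   coefficient [A']. *)
rewrite -(ltr0z R) -(pmulr_lgt0 _ (_ : 0 < (T_B2 r).1 * (T_B2 r).2)).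
  by rewrite e ltr0z.
by rewrite mulr_gt0// (lt_trans _ Tr1).
Qed.

Lemma pigeonhole_nat (T : finType) (f : nat -> T) :
  exists i j : nat, (i < j)%N /\ f i = f j.
Proof.
have [/injectiveP /leq_card|/injectivePn] :=
  boolP (injectiveb (fun i : 'I_#|T|.+1 => f i)).
  by rewrite card_ord ltnn.
move=> [i [j ij fij]].
have [lij|lji|/val_inj eij] := ltngtP i j.
- by exists i, j.
- by exists j, i.
- by rewrite eij eqxx in ij.
Qed.

(** Both pairs have the same sum and product, and the root above 1 cannot be exchanged with the one
    below 1. *)
Lemma reduced_pair_quadratic_eq (R : realType) (A B C : int) (p q : R * R) :
  reduced_pair p -> reduced_pair q ->
  quadratic_pair A B C p.1 p.2 -> quadratic_pair A B C q.1 q.2 -> p = q.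
Proof.
case: p q => [x y] [z t] [/= _ x1 /andP[_ y1]] [/= _ z1 /andP[_ t1]].
move=> [A0 sy py] [_ st pt].
have AR : A%:~R != 0 :> R by rewrite intr_eq0.
have s : x + y = z + t by apply: (mulfI AR); rewrite sy st.
have m : x * y = z * t by apply: (mulfI AR); rewrite py pt.
have : (x - z) * (x - t) = 0.
  have -> : (x - z) * (x - t) = x * (x - (z + t)) + z * t by ring.
  by rewrite -s -m; ring.
move/eqP; rewrite mulf_eq0 !subr_eq0 => /orP[/eqP xz|/eqP xt]; last by exfalso; lra.
by move: s; rewrite xz => /addrI ->.
Qed.

Lemma reduced_pair_periodic (R : realType) (A B C : int) (p : R * R) :
  reduced_pair p -> 0 < A -> quadratic_pair A B C p.1 p.2 ->
  exists2 n : nat, (1 <= n)%N & iter n (@T_B2 R) p = p.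
Proof.
move=> pr A0 q.
have [f fP] := choice
  (fun n => exists_quadratic_pair_iter_discr n pr A0 q).
set D := B ^+ 2 - 4 * A * C in fP.
(* A form is recorded by A, C and A + B + C: their signs are known and their absolute values are at
   most [D], so neither [absz] nor [inord] loses information. *)
pose code n : 'I_(absz D).+1 * 'I_(absz D).+1 * 'I_(absz D).+1 :=
  (inord (absz (f n).1.1), inord (absz (f n).2),
   inord (absz ((f n).1.1 + (f n).1.2 + (f n).2))).
have [i [j [ij eij]]] := pigeonhole_nat code.
have bnd n := let: And3 a b c := fP n in
  reduced_pair_coef_bound (iter_reduced_pair n pr) a b.
have fij : f i = f j.
  have [ai _ di] := fP i; have [aj _ dj] := fP j.
  have := bnd i; have := bnd j; rewrite di dj.
  case: eij => /(congr1 val) /= e1 /(congr1 val) /= e2 /(congr1 val) /= e3.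
  move: ai aj e1 e2 e3.
  case: (f i) => [[a b] c]; case: (f j) => [[a' b'] c'] /=.
  move=> ai aj + + + [? ? ? ? ?] [? ? ? ? ?].
  rewrite !inordK; try lia.
  by move=> ? ? ?; congr (_, _, _); lia.
have pij : iter i (@T_B2 R) p = iter j (@T_B2 R) p.
  have [_ qi _] := fP i; have [_ qj _] := fP j; rewrite fij in qi.
  exact: reduced_pair_quadratic_eq (iter_reduced_pair i pr)
    (iter_reduced_pair j pr) qi qj.
exists (j - i)%N; first by rewrite subn_gt0.
have {pij} : iter i (@T_B2 R) p = iter i (@T_B2 R) (iter (j - i) (@T_B2 R) p).
  by rewrite -iterD subnKC // ltnW.
have := iter_reduced_pair (j - i) pr.
move: (iter (j - i) _ p) => r rr.
(* Injectivity cancels the [i] common steps one at a time. *)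
elim: i {ij eij fij} => //= i IH /T_B2_inj e.
by apply/IH/e; exact: iter_reduced_pair.
Qed.

(** * Conjugates along a periodic orbit *)

Lemma T_B2_diff (R : realType) (p : R * R) :
  irrational p.1 -> 1 <= (T_B2 p).2 ->
  (T_B2 p).1 - (T_B2 p).2 = (p.1 - p.2) * ((T_B2 p).1 * (T_B2 p).2).
Proof.
case: p => x y xI; rewrite /T_B2 /T_B /= => y1.
(* If [y] were the digit, the second coordinate would be the default inverse 0, against the lower
   bound 1. *)
have ay : (bcf_digit x)%:~R - y != 0.
  by apply/eqP => e; move: y1; rewrite e invr0 ler10.
have ax : (bcf_digit x)%:~R - x != 0.
  by rewrite subr_eq0 eq_sym irrational_neq_int.
by field; rewrite ax ay.
Qed.

(** A double root would be the rational number -B / (2 A). *)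
Lemma quadratic_pair_neq (R : realType) (A B C : int) (x y : R) :
  irrational x -> quadratic_pair A B C x y -> x != y.
Proof.
move=> xI [A0 sy _]; apply/eqP => xy.
have : (2 * A)%:~R * x = (- B)%:~R.
  by rewrite intrM rmorphN /= -sy -xy; ring.
by move=> /(irrational_linear_eq0 xI)/eqP; rewrite mulf_eq0 (negbTE A0).
Qed.

(* Once the conjugate drops below 1 it enters ]0, 1[ and stays there; if it
   never does, the distance to the conjugate strictly increases. *)
Lemma periodic_reduced_pair (R : realType) (A B C : int) (p : R * R) n :
  irrational p.1 -> 1 < p.1 -> quadratic_pair A B C p.1 p.2 ->
  (1 <= n)%N -> iter n (@T_B2 R) p = p -> reduced_pair p.
Proof.
move=> pI p1 q n1 pn; pose P i := iter i (@T_B2 R) p.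
have PI i : irrational (P i).1.
  by rewrite iter_T_B2_fst; exact: irrational_iter_T_B.
have P1 i : 1 < (P i).1 by rewrite iter_T_B2_fst; exact: iter_T_B_gt1.
have [[i Pi]|noP] := pselect (exists i, (P i).2 < 1).
  have r : reduced_pair (P i.+1) by exact: reduced_pair_T_B2.
  (* Periodicity puts [p] at a position not before [i.+1], hence in the reduced part of the
     orbit. *)
  have -> : p = P (i.+1 * n)%N.
    by rewrite /P iterM; elim: (i.+1) => //= k <-.
  rewrite -(subnK (leq_pmulr i.+1 n1)) /P iterD.
  exact: iter_reduced_pair.
have P2 i : 1 <= (P i).2.
  by rewrite leNgt; apply/negP => Pi; apply: noP; exists i.
pose d i := `|(P i).1 - (P i).2|.
have dS i : 0 < d i -> d i < d i.+1.
  move=> di; rewrite /d /P iterS T_B2_diff ?(P2 i.+1)//; last exact: PI.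
  (* The distance is multiplied by a product of one factor above 1 and one at least 1. *)
  rewrite normrM -[ltLHS]mulr1 ltr_pM2l//.
  have Q1 := P1 i.+1; have Q2 := P2 i.+1.
  by rewrite ger0_norm; rewrite /P iterS in Q1 Q2; nra.
have d0 : 0 < d 0 by rewrite normr_gt0 subr_eq0; exact: quadratic_pair_neq q.
have dlt i : d 0 < d i.+1.
  elim: i => [|i IH]; first exact: dS.
  by apply: (lt_trans IH); apply: dS; exact: lt_trans d0 IH.
by have := dlt n.-1; rewrite prednK// /d /P pn ltxx.
Qed.

(** After [n] steps the second coordinate is still a conjugate of [p.1], which has only one. *)
Lemma iter_T_B2_periodic (R : realType) (A B C : int) (p : R * R) n :
  irrational p.1 -> quadratic_pair A B C p.1 p.2 ->
  iter n (@T_B R) p.1 = p.1 -> iter n (@T_B2 R) p = p.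
Proof.
move=> pI q pn; have [A' [B' [C' q']]] := exists_quadratic_pair_iter n pI q.
have e1 : (iter n (@T_B2 R) p).1 = p.1 by rewrite iter_T_B2_fst.
rewrite e1 in q'; have e2 := quadratic_pair_unique pI q' q.
by rewrite [LHS]surjective_pairing e1 e2 -surjective_pairing.
Qed.

(** * Convergence of the expansion along a periodic orbit *)

(** Here [u] lists the complete quotients. If [c] is the convergent of the tail, the error is (c -
    u_1) / (u_1 c), where u_1 >= m and c >= 1; so each further digit gains a factor 1/m. *)
Lemma bcf_convergent_error (R : realType) (u : nat -> R) (a : nat -> int) m N :
  1 < m -> (forall i, m <= u i) -> (forall i, u i = (a i)%:~R - (u i.+1)^-1) ->
  0 <= bcf_convergent R a N - u 0%N <= m^-1 ^+ N.
Proof.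
move=> m1; have m0 : 0 < m by lra.
elim: N u a => [|N IH] u a um ua.
  have u1 := um 1%N.
  rewrite [u 0%N]ua /= expr0 opprB addrC subrK invr_ge0 invf_le1; last by lra.
  by apply/andP; split; lra.
have /andP[lo hi] := IH (fun i => u i.+1) (fun i => a i.+1)
  (fun i => um i.+1) (fun i => ua i.+1).
rewrite [u 0%N]ua /=.
move: (bcf_convergent _ _ _) lo hi => c lo hi.
have u1 := um 1%N; have c1 : m <= c by lra.
have u0 : u 1%N != 0 by apply/eqP; lra.
have c0 : c != 0 by apply/eqP; lra.
have -> : (a 0%N)%:~R - c^-1 - ((a 0%N)%:~R - (u 1%N)^-1)
  = (u 1%N)^-1 * ((c - u 1%N) * c^-1) by field; rewrite c0 u0.
have cV : 0 <= c^-1 <= 1.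
  by rewrite invr_ge0 invf_le1; [apply/andP; split; lra | lra].
have uV : 0 <= (u 1%N)^-1 <= m^-1.
  by rewrite invr_ge0 lef_pV2 ?posrE; [apply/andP; split; lra | lra | lra].
move: cV uV => /andP[cV0 cV1] /andP[uV0 uV1].
apply/andP; split; first by rewrite !mulr_ge0.
rewrite exprS ler_pM// ?mulr_ge0//.
apply: le_trans hi; rewrite -[leRHS]mulr1; exact: ler_wpM2l.
Qed.

(** The minimum over one period serves; it supplies the uniform [m] that makes the error decay
    geometrically. *)
Lemma periodic_lower_bound (R : realType) (u : nat -> R) n :
  (1 <= n)%N -> (forall i, u (i + n)%N = u i) -> (forall i, 1 < u i) ->
  exists2 m, 1 < m & forall i, m <= u i.
Proof.
move=> n1 un u1.
have [m m1 mu] : exists2 m, 1 < m & forall i, (i < n)%N -> m <= u i.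
  elim: n {n1 un} => [|n [m m1 mu]]; first by exists 2 => //; lra.
  exists (Num.min m (u n)); first by rewrite lt_min m1 u1.
  move=> i; rewrite ltnS leq_eqVlt ge_min => /orP[/eqP ->|/mu ->//].
  by rewrite lexx orbT.
exists m => // i; rewrite (divn_eq i n) addnC.
elim: (i %/ n)%N => [|k IH]; first by rewrite mul0n addn0 mu// ltn_pmod.
by rewrite mulSn addnCA addnC un.
Qed.

Lemma T_B_periodic_bcf (R : realType) (w : R) n :
  irrational w -> 1 < w -> (1 <= n)%N -> iter n (@T_B R) w = w ->
  purely_periodic_bcf w.
Proof.
move=> wI w1 n1 wn; pose u i := iter i (@T_B R) w.
have un i : u (i + n)%N = u i by rewrite /u iterD wn.
have u1 i : 1 < u i by exact: iter_T_B_gt1.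
exists (fun i => bcf_digit (u i)), n; split=> [|//|i]; last by rewrite un.
split=> [i|]; first exact: bcf_digit_ge2.
have [m m1 mu] := periodic_lower_bound n1 un u1.
have ua i : u i = (bcf_digit (u i))%:~R - (u i.+1)^-1 by exact: T_B_inv.
apply/subr_cvg0 => /=.
apply: (squeeze_cvgr (f := fun=> 0) (h := fun N => m^-1 ^+ N)).
- by near=> N; exact: (bcf_convergent_error N m1 mu ua).
- exact: cvg_cst.
- apply: cvg_expr; rewrite ger0_norm ?invr_ge0; last by lra.
  by rewrite invf_lt1; lra.
Unshelve. all: by end_near. Qed.

(** * The Gauss shift acting on infinite expansions *)

Lemma bcf_convergent_gt1 (R : realType) (a : nat -> int) N :
  (forall i, 2 <= a i) -> 1 < bcf_convergent R a N.
Proof.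
elim: N a => [|N IH] a a2 /=;
  have : 2 <= (a 0%N)%:~R :> R by rewrite (ler_int _ 2).
  by lra.
have c1 := IH (fun i => a i.+1) (fun i => a2 i.+1).
move: (bcf_convergent _ _ _) c1 => c c1 a2R.
have : c^-1 < 1 by rewrite invf_lt1; lra.
lra.
Qed.

(** The inverses of the tail convergents lie in ]0, 1[ and tend to a_0 - w. Irrationality keeps this
    limit off 0 and 1, so a_0 is the digit of [w] and inversion is continuous at the limit. *)
Lemma bcf_expansion_T_B (R : realType) (w : R) (a : nat -> int) :
  irrational w -> bcf_expansion w a ->
  bcf_expansion (T_B w) (fun i => a i.+1).
Proof.
move=> wI [a2 aw]; split=> [i|]; first exact: a2.
pose c N := bcf_convergent R (fun i => a i.+1) N.
have c1 N : 1 < c N by apply: bcf_convergent_gt1.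
have cV N : 0 < (c N)^-1 < 1.
  by rewrite invr_gt0 invf_lt1; [apply/andP; split|]; have := c1 N; lra.
have cw : (c N)^-1 @[N --> \oo] --> (a 0%N)%:~R - w.
  have -> : (fun N => (c N)^-1) =
    (fun N => (a 0%N)%:~R - bcf_convergent R a N.+1).
    by apply/funext => N /=; rewrite opprB addrC subrK.
  apply: cvgB; first exact: cvg_cst.
  by rewrite (cvg_shiftS (bcf_convergent R a)).
have lo : 0 <= (a 0%N)%:~R - w.
  rewrite -(cvg_lim _ cw)//; apply: limr_ge.
    by apply/cvg_ex; eexists; exact: cw.
  by near=> N; have /andP[/ltW] := cV N.
have hi : (a 0%N)%:~R - w <= 1.
  rewrite -(cvg_lim _ cw)//; apply: limr_le.
    by apply/cvg_ex; eexists; exact: cw.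
  by near=> N; have /andP[_ /ltW] := cV N.
have dw : bcf_digit w = a 0%N.
  apply: bcf_digit_unique.
  have := irrational_neq_int (a 0%N) wI.
  have := irrational_neq_int (a 0%N - 1) wI.
  rewrite intrD rmorphN /= => n1 n0.
  by rewrite !lt_neqAle n0 eq_sym n1 /=; apply/andP; split; lra.
have aw0 : (a 0%N)%:~R - w != 0.
  by rewrite subr_eq0 eq_sym irrational_neq_int.
rewrite /T_B dw.
rewrite (_ : bcf_convergent R _ = fun N => ((c N)^-1)^-1).
  exact: cvgV aw0 cw.
by apply/funext => N; rewrite invrK.
Unshelve. all: by end_near. Qed.

Lemma bcf_expansion_iter_T_B (R : realType) (w : R) (a : nat -> int) n :
  irrational w -> bcf_expansion w a ->
  bcf_expansion (iter n (@T_B R) w) (fun i => a (i + n)%N).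
Proof.
move=> wI wa; elim: n => [|n IH]; first by under eq_fun do rewrite addn0.
rewrite (_ : (fun i => a (i + n.+1)%N) = fun i => a (i.+1 + n)%N).
  exact: (bcf_expansion_T_B (irrational_iter_T_B wI) IH).
by apply/funext => i; rewrite addnS.
Qed.

(** After one period of shifts the digits are the same, and so is the limit of their convergents. *)
Lemma purely_periodic_bcf_T_B (R : realType) (w : R) :
  irrational w -> purely_periodic_bcf w ->
  exists2 n : nat, (1 <= n)%N & iter n (@T_B R) w = w.
Proof.
move=> wI [a [n [wa n1 an]]]; exists n => //.
have [_] := bcf_expansion_iter_T_B n wI wa.
rewrite (_ : (fun i => a (i + n)%N) = a); last exact/funext.
by move=> l; case: wa => _ l'; exact: cvg_unique l l'.
Qed.

(** * Minimal polynomials and the Galois conjugate *)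

Lemma quadratic_irrational_irrational (R : realType) (w : R) :
  quadratic_irrational w -> irrational w.
Proof.
move=> [p [pm pirr pw] sp]; apply/irrationalP => q wq.
move: pw; rewrite wq fmorph_root => pq.
have := apply_irredp pirr _ (_ : 'X - q%:P %| p).
rewrite size_XsubC dvdp_XsubCl => /(_ isT pq)/eqp_size.
by rewrite sp size_XsubC.
Qed.

(** Irreducible polynomials that do not divide one another are coprime, which a common root
    forbids. *)
Lemma min_poly_unique (R : realType) (x : R) (p q : {poly rat}) :
  is_min_poly x p -> is_min_poly x q -> p = q.
Proof.
move=> [pm pirr px] [qm qirr qx].
apply/eqP; rewrite -eqp_monic//; apply: apply_irredp => //.
  by case: pirr => sp _; rewrite gtn_eqF.
apply: contraT => npq.
have : coprimep p q by rewrite irreducible_poly_coprime.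
rewrite -(coprimep_map (@ratr R)) => /coprimep_root/(_ px).
by move: qx; rewrite rootE => /eqP ->; rewrite eqxx.
Qed.

Lemma galois_conj_quadratic_pair (R : realType) (w : R) :
  quadratic_irrational w ->
  exists A B C : int, 0 < A /\ quadratic_pair A B C w (galois_conj w).
Proof.
move=> wq; have wI := quadratic_irrational_irrational wq.
have [p mp sp] := wq; have [pm _ pw] := mp.
pose b : rat := p`_1; pose c : rat := p`_0.
have p2 : p`_2 = 1 by move/monicP: pm; rewrite lead_coefE sp.
have pE z : (map_poly ratr p).[z] = z ^+ 2 + ratr b * z + ratr c :> R.
  rewrite horner_coef size_map_poly sp !big_ord_recl big_ord0 /=.
  rewrite !coef_map /= p2 rmorph1 /b /c; ring.
have {}pw : w ^+ 2 + ratr b * w + ratr c = 0 by rewrite -pE; exact/eqP.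
have wE : galois_conj w = - ratr b - w.
  apply: xget_unique => [|z [_ [q [mq qz zw]]]].
    split=> //; exists p; split=> //.
      by rewrite rootE pE -pw; apply/eqP; ring.
    (* Equal roots would make [w] equal to the rational -b/2. *)
    apply/eqP => e; move/irrationalP: wI => /(_ (- b / 2%:R)); apply.
    by rewrite rmorphM fmorphV rmorphN /= ratr_nat; lra.
  move: qz; rewrite -(min_poly_unique mp mq) rootE pE => /eqP ez.
  have : (z - w) * (z + ratr b + w) = 0.
    have -> : (z - w) * (z + ratr b + w) = (z ^+ 2 + ratr b * z + ratr c)
      - (w ^+ 2 + ratr b * w + ratr c) by ring.
    by rewrite ez pw subrr.
  by move/eqP; rewrite mulf_eq0 subr_eq0 (negbTE zw) /= => /eqP; lra.
(* The minimal polynomial X^2 + b X + c is cleared of denominators by a positive factor. *)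
exists (denq b * denq c), (numq b * denq c), (numq c * denq b).
have rE (q : rat) : ratr q * (denq q)%:~R = (numq q)%:~R :> R.
  rewrite -[q in ratr q]divq_num_den rmorphM fmorphV /= !ratr_int.
  by rewrite mulfVK// intr_eq0 denq_neq0.
split; first by rewrite mulr_gt0 ?denq_gt0.
split; first by rewrite mulf_neq0 ?denq_neq0.
  by rewrite wE !intrM -rE; ring.
have cE : ratr c = w * (- ratr b - w) by lra.
by rewrite wE !intrM -rE cE; ring.
Qed.

Theorem proposition27 (R : realType) (w : R)
    (quad_w : quadratic_irrational w) (w_gt1 : 1 < w) :
  [<-> B_reduced w;
       purely_periodic_bcf w;
       exists2 n : nat, (1 <= n)%N & iter n (@T_B R) w = w].
Proof.
have wI := quadratic_irrational_irrational quad_w.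
have [A [B [C [A0 q]]]] := galois_conj_quadratic_pair quad_w.
pose p := (w, galois_conj w).
tfae.
(* The orbit of the pair is shown periodic first; its first coordinate then gives the digits. *)
- move=> [_ _ w'01]; have pr : reduced_pair p by [].
  have [n n1 pn] := reduced_pair_periodic pr A0 q.
  by apply: T_B_periodic_bcf n1 _ => //; rewrite -[w]/p.1 -iter_T_B2_fst pn.
- exact: purely_periodic_bcf_T_B.
- move=> [n n1 wn]; have pn := @iter_T_B2_periodic _ _ _ _ p n wI q wn.
  by have [] := @periodic_reduced_pair _ _ _ _ p n wI w_gt1 q n1 pn.
Qed.
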